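(* Let $\mathcal{B}$ be an M-basis in $\mathbb{X}$ and let $\tau\in(0,1]$. Then for every $m\in\mathbb{N}$, $$\max\left\{g^c_{m,\tau},\ \frac{\nu_{m,\tau}}{\tau}\right\}\ \le\ \widetilde{\mathbf L}_{m,\tau}\ \le\ \frac{g^c_{m-1,\tau}\,\nu_{m,\tau}}{\tau}.$$
   Context: Setting. $(\mathbb{X},\|\cdot\|)$ is an infinite-dimensional Banach space over $\mathbb{F}=\mathbb{R}$ or $\mathbb{C}$ with dual $(\mathbb{X}^*,\|\cdot\|_* )$. A (semi-normalized Markushevich) M-basis is a sequence $\mathcal{B}=(e_n)_{n=1}^\infty$ in $\mathbb{X}$ such that: (1) there is a unique collection $(e_n^* )_{n=1}^\infty\subset\mathbb{X}^*$ with $e_i^*(e_j)=\delta_{i,j}$; (2) $0<\inf_n\{\|e_n\|,\|e_n^*\|_*\}\le\sup_n\{\|e_n\|,\|e_n^*\|_*\}<\infty$; (3) $\mathbb{X}=\overline{\mathrm{span}\{e_n:n\in\mathbb{N}\}}$; (4) $\mathbb{X}^*=\overline{\mathrm{span}\{e_n^*:n\in\mathbb{N}\}}^{w^*}$. Notation. $\mathrm{supp}(x)=\{n:e_n^*(x)\ne0\}$, $\|x\|_\infty=\sup_n|e_n^*(x)|$, and $P_A(x)=\sum_{n\in A}e_n^*(x)e_n$ for finite $A\subset\mathbb{N}$. A sign is a sequence $\varepsilon=(\varepsilon_n)\subset\mathbb{F}$ with $|\varepsilon_n|=1$, and $1_{\varepsilon A}=\sum_{n\in A}\varepsilon_ne_n$.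 $A\sqcup B\sqcup x$ means that $A$, $B$, $\mathrm{supp}(x)$ are pairwise disjoint. Weak greedy sets. A finite $\Lambda\subset\mathbb{N}$ is a $\tau$-weak greedy set of $x$ if $\min_{n\in\Lambda}|e_n^*(x)|\ge\tau\max_{n\notin\Lambda}|e_n^*(x)|$ (the empty set is always allowed). $\mathcal{G}(x,m,\tau)$ is the collection of all $\tau$-weak greedy sets of $x$ of cardinality $m$, and $\gamma_{m,\tau}(x)=\sup\{\|x-P_\Lambda(x)\|:\Lambda\in\mathcal{G}(x,m,\tau)\}$. Lebesgue parameter. $\widetilde\sigma_m(x)=\inf\{\|x-P_A(x)\|:A\subset\mathbb{N},|A|=m\}$, and $\widetilde{\mathbf L}_{m,\tau}$ is the smallest constant such that $\gamma_{m,\tau}(x)\le\widetilde{\mathbf L}_{m,\tau}\widetilde\sigma_m(x)$ for all $x\in\mathbb{X}$. Constants. For $m\in\mathbb{N}\cup\{0\}$, $g^c_{m,\tau}$ is the smallest $C\in[0,\infty]$ such that $\|x-P_\Lambda(x)\|\le C\|x\|$ for all $x\in\mathbb{X}$, all $0\le k\le m$ and all $\Lambda\in\mathcal{G}(x,k,\tau)$. The (A,$\tau$)-property constant is $$\nu_{m,\tau}=\sup\left\{\frac{\|\tau x+1_{\delta B}\|}{\|x+1_{\varepsilon A}\|}: x\in\mathbb{X},\ \|x\|_\infty\le 1/\tau,\ A,B\subset\mathbb{N},\ |A|=|B|\le m,\ A\sqcup B\sqcup x,\ (\varepsilon),(\delta)\text{ signs}\right\},$$ where only quotients with nonzero denominator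 are considered. *)

(* Defs.v *)
From HB Require Import structures.
From mathcomp Require Import all_boot all_order all_algebra finmap.
From mathcomp Require Import all_classical all_reals all_analysis.
From mathcomp Require Import complex.

Set Implicit Arguments.
Unset Strict Implicit.
Unset Printing Implicit Defensive.

Import Order.TTheory GRing.Theory Num.Theory.
Import numFieldNormedType.Exports.

Local Open Scope classical_set_scope.
Local Open Scope ring_scope.

Variant scalar_field := RealScalars | ComplexScalars.

Definition scalars (R : realType) (k : scalar_field) : numFieldType :=
  match k with
  | RealScalars => R : numFieldType
  | ComplexScalars => R[i] : numFieldType
  end.

Definition of_real (R : realType) (k : scalar_field) : R -> scalars R k :=
  match k return R -> scalars R k with
  | RealScalars => fun t => t
  | ComplexScalars => fun t => Complex t 0
  end.

Definition real_part (R : realType) (k : scalar_field) : scalars R k -> R :=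
  match k return scalars R k -> R with
  | RealScalars => fun t => t
  | ComplexScalars => fun z => complex.Re z
  end.

(* The library's norm `|x| takes its values in the scalar field (in R[i] when
   the scalars are complex); [nrm] is the same quantity as an element of R. *)
Definition nrm (R : realType) (k : scalar_field)
  (V : normedZmodType (scalars R k)) (x : V) : R := real_part `|x|.

Definition seq_span (K : numFieldType) (V : lmodType K) (u : nat -> V) : set V :=
  [set v | exists (N : nat) (a : nat -> K), v = \sum_(i < N) a i *: u i].

Definition infinite_dimensional (K : numFieldType) (V : lmodType K) : Prop :=
  ~ exists s : seq V, forall x : V,
      exists a : nat -> K, x = \sum_(i < size s) a i *: s`_i.

Section MBasis.
Context (R : realType) (k : scalar_field).
Local Notation K := (scalars R k).
Context (X : normedModType K).

Definition dual_norm (f : {linear X -> K^o}) : \bar R :=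
  ereal_sup [set (nrm (f x : K))%:E | x in [set x : X | nrm x <= 1]].

Definition biorthogonal (e : nat -> X) (es : nat -> {linear X -> K^o}) : Prop :=
  forall i j : nat, es i (e j) = (i == j)%:R.

(* [es] is the sequence of coordinate functionals e_n^*.  In the last clause
   the w*-closure in X^* is the trace on X^* of the closure for the topology of
   pointwise convergence on functions X -> K. *)
Record Mbasis (e : nat -> X) (es : nat -> {linear X -> K^o}) : Prop := {
  mb_continuous : forall n, continuous (es n : X -> K);
  mb_biorthogonal : biorthogonal e es;
  mb_unique : forall fs : nat -> {linear X -> K^o},
    (forall n, continuous (fs n : X -> K)) -> biorthogonal e fs ->
    forall n, (fs n : X -> K) = es n;
  mb_seminormalized :
    let S := range (fun n => (nrm (e n))%:E)
             `|` range (fun n => dual_norm (es n)) in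
    [/\ (0 < ereal_inf S)%E,
        (ereal_inf S <= ereal_sup S)%E &
        (ereal_sup S < +oo)%E];
  mb_complete : closure (seq_span e) = setT;
  mb_total : forall f : {linear X -> K^o}, continuous (f : X -> K) ->
    closure (seq_span (fun n => es n : X -> K^o) : set {ptws X -> K}) f
}.

Definition is_sign (eps : nat -> K) : Prop := forall n, `|eps n| = 1.

Context (e : nat -> X) (es : nat -> {linear X -> K^o}).

Definition supp (x : X) : set nat := [set n | es n x != 0].

Definition coef_abs (x : X) (n : nat) : \bar R := (nrm (es n x : K))%:E.

Definition norm_infty (x : X) : \bar R := ereal_sup (range (coef_abs x)).

Definition proj (A : {fset nat}) (x : X) : X := \sum_(n <- A) es n x *: e n.

Definition signed_ind (eps : nat -> K) (A : {fset nat}) : X :=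
  \sum_(n <- A) eps n *: e n.

(* Every set is allowed at [L = fset0], because the infimum of the empty set
   is [+oo]. *)
Definition weak_greedy (tau : R) (x : X) (L : {fset nat}) : Prop :=
  (tau%:E * ereal_sup [set coef_abs x n | n in [set n | n \notin L]]
   <= ereal_inf [set coef_abs x n | n in [set n | n \in L]])%E.

Definition greedy_sets (x : X) (m : nat) (tau : R) : set {fset nat} :=
  [set L | weak_greedy tau x L /\ #|` L| = m].

Definition greedy_error (m : nat) (tau : R) (x : X) : \bar R :=
  ereal_sup [set (nrm (x - proj L x))%:E | L in greedy_sets x m tau].

Definition proj_error (m : nat) (x : X) : \bar R :=
  ereal_inf [set (nrm (x - proj A x))%:E | A in [set A | #|` A| = m]].

(* [greedy_error] and [proj_error] are the paper's gamma and sigma-tilde.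
   The product +oo * 0 is 0 in \bar R; this does not affect the infimum,
   which is +oo as soon as no real constant is admissible. *)
Definition lebesgue (m : nat) (tau : R) : \bar R :=
  ereal_inf [set C : \bar R | (0 <= C)%E /\
    forall x : X, (greedy_error m tau x <= C * proj_error m x)%E].

Definition gc (m : nat) (tau : R) : \bar R :=
  ereal_inf [set C : \bar R | (0 <= C)%E /\
    forall (x : X) (j : nat) (L : {fset nat}), (j <= m)%N ->
      greedy_sets x j tau L ->
      ((nrm (x - proj L x))%:E <= C * (nrm x)%:E)%E].

Definition nu_admissible (m : nat) (tau : R) (x : X) (A B : {fset nat})
    (eps delta : nat -> K) : Prop :=
  [/\ (norm_infty x <= (tau^-1)%:E)%E,
      #|` A| = #|` B| /\ (#|` A| <= m)%N,
      [/\ [disjoint A & B]%fset, [set` A] `&` supp x = set0 &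
          [set` B] `&` supp x = set0],
      is_sign eps /\ is_sign delta &
      nrm (x + signed_ind eps A) != 0].

Definition nu (m : nat) (tau : R) : \bar R :=
  ereal_sup [set q : \bar R |
    exists (x : X) (A B : {fset nat}) (eps delta : nat -> K),
      nu_admissible m tau x A B eps delta /\
      q = (nrm (of_real k tau *: x + signed_ind delta B)
           / nrm (x + signed_ind eps A))%:E].

End MBasis.

(* Main.v *)
(* Lower bound.  The coefficients of any vector tend to 0, so a vector can be
   changed, at negligible cost, into one with huge coefficients on a remote set
   of prescribed size.  Adding that set to a greedy set and to its competitor
   extends the Lebesgue inequality at size m to all sizes j <= m.  A remote
   competitor then gives g^c_m, and the vector x + 1_{eps A} + 1_{delta B} / tau
   with greedy set A and competitor B gives nu_m / tau.

   Upper bound.  Let L be greedy for x and |A| = |L| = m, let z be x with the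
   coefficients on A and L removed, and t = min_{L \ A} |e_n^*(x)|.  By convexity
   ||x - P_L x|| is at most sup_delta ||z + (t / tau) 1_{delta, A \ L}||, hence
   at most (nu_m / tau) ||z + t 1_{eps, L \ A}|| with eps the signs of x.  That
   last vector is x - P_A x truncated at height t on L \ A, i.e. an average of
   remainders of x - P_A x after weak greedy sets with at most m - 1 elements. *)

Require Import Defs.
From HB Require Import structures.
From mathcomp Require Import all_boot all_order all_algebra finmap.
From mathcomp Require Import all_classical all_reals all_analysis.
From mathcomp Require Import complex ring lra.

Set Implicit Arguments.
Unset Strict Implicit.
Unset Printing Implicit Defensive.

Import Order.TTheory GRing.Theory Num.Theory.
Import numFieldNormedType.Exports.

Local Open Scope classical_set_scope.
Local Open Scope ring_scope.

(* [all_analysis] has a [proj] of its own. *)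
Local Notation proj := Defs.proj.

(** * Real-valued norms over either scalar field *)

Section RealNorm.
Context (R : realType) (k : scalar_field).
Local Notation K := (scalars R k).

Lemma of_realK (t : R) : real_part (of_real k t) = t.
Proof. by case: k. Qed.

Lemma of_real1 : of_real k 1 = 1 :> K.
Proof. by case: k. Qed.

Lemma of_real0 : of_real k 0 = 0 :> K.
Proof. by case: k. Qed.

Lemma of_realD (s t : R) : of_real k (s + t) = of_real k s + of_real k t.
Proof. by case: k => //=; rewrite -(rmorphD (real_complex R)). Qed.

Lemma of_realM (s t : R) : of_real k (s * t) = of_real k s * of_real k t.
Proof. by case: k => //=; rewrite -(rmorphM (real_complex R)). Qed.

Lemma of_realN (t : R) : of_real k (- t) = - of_real k t.
Proof. by apply/eqP; rewrite -addr_eq0 -of_realD addNr of_real0. Qed.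

Lemma of_real_le (s t : R) : (of_real k s <= of_real k t) = (s <= t).
Proof. by case: k => //=; rewrite lecR. Qed.

Lemma of_real_lt (s t : R) : (of_real k s < of_real k t) = (s < t).
Proof. by case: k => //=; rewrite ltcR. Qed.

Lemma norm_of_real (t : R) : `|of_real k t| = of_real k `|t|.
Proof. by case: k => //=; rewrite (normc_def (t%:C)%C) /= expr0n addr0 sqrtr_sqr. Qed.

(** In the order of [R[i]] a nonnegative element has zero imaginary part, so passing to the real
    part loses nothing. *)
Lemma of_real_part (a : K) : 0 <= a -> of_real k (real_part a) = a.
Proof. by case: k a => //= -[a b]; rewrite lecE /= => /andP[/eqP -> _]. Qed.

Context (V : normedModType K).
Implicit Types (x y : V) (a : K) (r : R).

Lemma nrmE x : `|x| = of_real k (nrm x).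
Proof. by rewrite /nrm of_real_part. Qed.

Lemma nrmP x r : (nrm x <= r) = (`|x| <= of_real k r).
Proof. by rewrite nrmE of_real_le. Qed.

Lemma nrm_of_real r : nrm (of_real k r : K) = `|r|.
Proof. by rewrite /nrm norm_of_real of_realK. Qed.

Lemma nrm_ge0 x : 0 <= nrm x.
Proof. by rewrite -of_real_le of_real0 -nrmE. Qed.

Lemma nrm0 : nrm (0 : V) = 0.
Proof. by rewrite /nrm normr0 -of_real0 of_realK. Qed.

Lemma nrm_eq0 x : (nrm x == 0) = (x == 0).
Proof.
apply/eqP/eqP => [h|->]; last exact: nrm0.
by apply/eqP; rewrite -normr_eq0 nrmE h of_real0.
Qed.

Lemma nrm_le_add x y : nrm (x + y) <= nrm x + nrm y.
Proof. by rewrite nrmP of_realD -!nrmE ler_normD. Qed.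

Lemma nrmN x : nrm (- x) = nrm x.
Proof. by rewrite /nrm normrN. Qed.

Lemma nrm_le_sub x y : nrm (x - y) <= nrm x + nrm y.
Proof. by rewrite -(nrmN y) nrm_le_add. Qed.

Lemma nrm_le_subC x y : nrm x <= nrm (x - y) + nrm y.
Proof. by rewrite -{1}(subrK y x) nrm_le_add. Qed.

Lemma nrmZ a x : nrm (a *: x) = nrm (a : K) * nrm x.
Proof.
rewrite {1}/nrm normrZ !nrmE.
have -> : `|a| = of_real k (nrm (a : K)) by rewrite /nrm of_real_part.
by rewrite -of_realM of_realK.
Qed.

Lemma nrmZr r x : 0 <= r -> nrm (of_real k r *: x) = r * nrm x.
Proof. by move=> r0; rewrite nrmZ nrm_of_real ger0_norm. Qed.

End RealNorm.

(** * Moduli and polar form of scalars *)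

Section Scalars.
Context (R : realType) (k : scalar_field).
Local Notation K := (scalars R k).

Lemma nrmM (a b : K) : nrm (a * b) = nrm a * nrm b.
Proof. exact: (@nrmZ R k K^o). Qed.

Lemma nrm_unit (a : K) : `|a| = 1 -> nrm a = 1.
Proof. by rewrite /nrm => ->; rewrite -of_real1 of_realK. Qed.

Lemma nrm_polar (a : K) :
  exists2 u : K, `|u| = 1 & a = of_real k (nrm a) * u.
Proof.
have [->|a0] := eqVneq a 0.
  by exists 1; rewrite ?normr1 // (@nrm0 R k K^o) of_real0 mul0r.
have na : of_real k (nrm a) = `|a| by rewrite /nrm of_real_part.
exists (a / `|a|); first by rewrite normrM normfV normr_id divff ?normr_eq0.
by rewrite na mulrCA divff ?mulr1 // normr_eq0.
Qed.

End Scalars.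

(** * Convexity: averages over signs and over tails of a list *)

Section Convexity.
Context (R : realType) (k : scalar_field).
Local Notation K := (scalars R k).
Context (V : normedModType K).

Lemma nrm_conv_le (M t : R) (x y : V) : 0 <= t <= 1 ->
  nrm x <= M -> nrm y <= M ->
  nrm (of_real k t *: x + of_real k (1 - t) *: y) <= M.
Proof.
move=> /andP[t0 t1] xM yM; apply: le_trans (nrm_le_add _ _) _.
rewrite !nrmZr ?subr_ge0 //.
have -> : M = t * M + (1 - t) * M by rewrite -mulrDl addrC subrK mul1r.
by rewrite lerD // ler_wpM2l // subr_ge0.
Qed.

(* A scalar of modulus at most [r] is a convex combination of two antipodal
   scalars of modulus [r], whether the scalars are real or complex. *)
Lemma nrm_le_signs (I : eqType) (v : I -> V) (r M : R) (s : seq I) (z : V) :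
  0 < r -> uniq s ->
  (forall d : I -> K, (forall i, `|d i| = 1) ->
     nrm (z + of_real k r *: \sum_(i <- s) d i *: v i) <= M) ->
  forall a : I -> K, (forall i, i \in s -> nrm (a i) <= r) ->
    nrm (z + \sum_(i <- s) a i *: v i) <= M.
Proof.
move=> r0; elim: s z => [|i s IH] z.
  move=> _ hM a _; rewrite big_nil.
  by have := hM (fun _ => 1) (fun _ => normr1 _); rewrite big_nil scaler0.
move=> /= /andP[is_ us] hM a ha.
(* The term at [i] is absorbed into the base vector, so the induction hypothesis only asks for signs
   on [s]. *)
rewrite big_cons addrA; apply: IH => // [d hd|j js]; last first.
  by rewrite ha // inE js orbT.
have [u u1 au] := nrm_polar (a i).
pose d' (c : K) j := if j == i then c else d j.
have hd' (c : K) : `|c| = 1 ->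
    nrm (z + of_real k r *: (c *: v i + \sum_(j <- s) d j *: v j)) <= M.
  move=> c1; have := hM (d' c); rewrite big_cons /d' eqxx.
  rewrite (eq_big_seq (fun j => d j *: v j)); first last.
    by move=> j js; case: eqP => // ji; rewrite -ji js in is_.
  by apply=> j; case: ifP.
have air : nrm (a i) <= r by rewrite ha // mem_head.
(* [t] solves [(2 * t - 1) * r = nrm (a i)]: weights [t] and [1 - t] on [r * u] and [- r * u]
   average to [a i]. *)
pose t := (1 + nrm (a i) / r) / 2.
have t01 : 0 <= t <= 1.
  have h0 : 0 <= nrm (a i) / r by rewrite divr_ge0 ?(@nrm_ge0 R k K^o) // ltW.
  have h1 : nrm (a i) / r <= 1 by rewrite ler_pdivrMr // mul1r.
  rewrite /t; lra.
have := nrm_conv_le t01 (hd' u u1) (hd' (- u) (etrans (normrN u) u1)).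
congr (nrm _ <= _).
have -> : a i *: v i = (of_real k t - of_real k (1 - t)) *:
    (of_real k r *: (u *: v i)).
  rewrite !scalerA -of_realN -of_realD {1}au -of_realM; congr ((of_real k _ * _) *: _).
  rewrite /t; field; exact: lt0r_neq0.
set S := \sum_(j <- s) _; rewrite scaleNr !scalerDr !scalerN.
rewrite addrACA -scalerDl [X in _ + X = _]addrACA -scalerBl -scalerDl.
have -> : of_real k t + of_real k (1 - t) = 1.
  by rewrite -of_realD addrCA subrr addr0 of_real1.
rewrite !scale1r.
by rewrite addrA.
Qed.

(* Summation by parts: the vector is an average of the sums over the tails of
   [s], each of which is a superlevel set of [h]. *)
Lemma nrm_le_tails (I : eqType) (v : I -> V) (h : I -> R) (z : V) (M : R)
    (s : seq I) (c : R) :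
  path <=%R c (map h s) -> last c (map h s) = 1 ->
  (forall p q, s = p ++ q -> (0 < size q)%N ->
     nrm (z + \sum_(i <- q) v i) <= M) ->
  nrm (of_real k (1 - c) *: z + \sum_(i <- s) of_real k (h i - c) *: v i)
    <= (1 - c) * M.
Proof.
elim: s c => [|i s IH] c /=.
  by move=> _ -> _; rewrite big_nil subrr of_real0 scale0r addr0 nrm0 mul0r.
move=> /andP[ci hs] hl hM.
have hM0 := hM [::] (i :: s) erefl erefl.
have hM1 p q : s = p ++ q -> (0 < size q)%N ->
    nrm (z + \sum_(j <- q) v j) <= M.
  by move=> sE; apply: (hM (i :: p)); rewrite sE.
have {IH hM1} := IH _ hs hl hM1.
have {hM0} : nrm (of_real k (h i - c) *: (z + \sum_(j <- i :: s) v j))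
    <= (h i - c) * M.
  by rewrite nrmZr ?subr_ge0 // ler_wpM2l // subr_ge0.
(* The range from [c] to 1 is cut at [h i]: the first piece weights the full tail [i :: s], the
   second is the induction hypothesis started at [h i]. *)
have -> : (1 - c) * M = (h i - c) * M + (1 - h i) * M by ring.
move=> h1 h2; apply: le_trans (lerD h1 h2).
apply: le_trans (nrm_le_add _ _); rewrite le_eqVlt; apply/orP; left; apply/eqP.
congr nrm; rewrite !big_cons !scalerDr scaler_sumr addrACA -scalerDl -of_realD.
congr (_ *: _ + _); first by congr of_real; ring.
rewrite -addrA -big_split /=; congr (_ + _); apply: eq_bigr => j _.
by rewrite -scalerDl -of_realD; congr (of_real k _ *: _); ring.
Qed.

End Convexity.

(** * Coefficients of finite sums, and pointwise forms of the extended-real conditions *)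

Section Coefficients.
Context (R : realType) (k : scalar_field).
Local Notation K := (scalars R k).
Context (X : normedModType K).
Variables (e : nat -> X) (es : nat -> {linear X -> K^o}).
Implicit Types (A B D L : {fset nat}) (a b : nat -> K) (x y : X).

Lemma projE A x : proj e es A x = signed_ind e (fun n => es n x) A.
Proof. by []. Qed.

Lemma eq_signed_ind A a b :
  {in A, a =1 b} -> signed_ind e a A = signed_ind e b A.
Proof. by move=> ab; apply: eq_big_seq => n /ab ->. Qed.

Lemma signed_indU a A B : [disjoint A & B]%fset ->
  signed_ind e a (A `|` B)%fset = signed_ind e a A + signed_ind e a B.
Proof.
move=> /fdisjointP AB.
rewrite /signed_ind -big_cat; apply: perm_big; apply: uniq_perm => //.
  rewrite cat_uniq !fset_uniq /= andbT; apply/hasPn => n nB.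
  by apply/negP => /AB; rewrite nB.
by move=> n; rewrite mem_cat in_fsetU.
Qed.

Lemma projU A B x : [disjoint A & B]%fset ->
  proj e es (A `|` B)%fset x = proj e es A x + proj e es B x.
Proof. exact: signed_indU. Qed.

Lemma signed_indZ (c : K) a A :
  signed_ind e (fun n => c * a n) A = c *: signed_ind e a A.
Proof. by rewrite scaler_sumr; apply: eq_bigr => n _; rewrite scalerA. Qed.

Lemma signed_indB a b A :
  signed_ind e (fun n => a n - b n) A = signed_ind e a A - signed_ind e b A.
Proof. by rewrite -sumrB; apply: eq_bigr => n _; rewrite scalerBl. Qed.

Lemma coef_signed_ind a A n : biorthogonal e es ->
  es n (signed_ind e a A) = if n \in A then a n else 0.
Proof.
move=> be; rewrite linear_sum /=.
rewrite (eq_bigr (fun i => if i == n then a n else 0)); last first.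
  move=> i _; rewrite linearZ /= be eq_sym; case: eqP => [->|_].
    exact: mulr1.
  exact: mulr0.
rewrite -big_mkcond /= -big_filter.
have -> : [seq i <- A | i == n] = if n \in A then [:: n] else [::].
  case: ifP => nA.
    by rewrite -(filter_pred1_uniq (fset_uniq A) nA).
  apply/eqP; rewrite -(negbK (_ == _)) -has_filter.
  by apply/hasPn => i iA; apply: contraFN nA => /eqP <-.
by case: ifP => _; rewrite ?big_seq1 ?big_nil.
Qed.

Lemma coef_proj A x n : biorthogonal e es ->
  es n (proj e es A x) = if n \in A then es n x else 0.
Proof. exact: coef_signed_ind. Qed.

Lemma weak_greedyP (tau : R) x L : 0 < tau ->
  weak_greedy es tau x L <->
  forall i n, i \notin L -> n \in L -> tau * nrm (es i x : K) <= nrm (es n x : K).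
Proof.
move=> t0; split=> [h i n iL nL|h].
  rewrite -lee_fin EFinM.
  have le_sup : (coef_abs es x i <=
      ereal_sup [set coef_abs es x j | j in [set j | j \notin L]])%E.
    by apply: ereal_sup_ubound; exists i.
  apply: le_trans (lee_wpmul2l _ le_sup) _; first by rewrite lee_fin ltW.
  apply: le_trans h _; apply: ereal_inf_lbound.
  by exists n.
apply: le_ereal_inf_tmp => _ [n nL <-].
rewrite -(invrK tau) lee_pdivrMl ?invr_gt0 //.
apply: ge_ereal_sup => _ [i iL <-].
rewrite /coef_abs -EFinM lee_fin ler_pdivlMl //; exact: h.
Qed.

Lemma norm_inftyP x (r : R) :
  (norm_infty es x <= r%:E)%E <-> forall n, nrm (es n x : K) <= r.
Proof.
split=> h.
  move=> n; rewrite -lee_fin; apply: le_trans h.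
  by apply: ereal_sup_ubound; exists n.
by apply: ge_ereal_sup => _ [n _ <-]; rewrite lee_fin.
Qed.

End Coefficients.

(** * Uniform bounds and decay of coefficients *)

Section MbasisBounds.
Context (R : realType) (k : scalar_field).
Local Notation K := (scalars R k).
Context (X : normedModType K).
Variables (e : nat -> X) (es : nat -> {linear X -> K^o}).
Hypothesis hB : Mbasis e es.

Lemma Mbasis_neq0 n : e n != 0.
Proof.
apply/eqP => en0; have := mb_biorthogonal hB n n.
by rewrite en0 linear0 eqxx => /esym/eqP; rewrite oner_eq0.
Qed.

Lemma Mbasis_bounded : exists2 M : R, 0 < M &
  forall n, nrm (e n) <= M /\ forall x, nrm (es n x : K) <= M * nrm x.
Proof.
have [_ _] := mb_seminormalized hB; set S := (_ `|` _)%classic => Sfin.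
have Se n : S (nrm (e n))%:E by left; exists n.
have Sd n : S (dual_norm (es n)) by right; exists n.
have S0 : (0 <= ereal_sup S)%E.
  by apply: le_trans (ereal_sup_ubound (Se 0%N)); rewrite lee_fin nrm_ge0.
pose M := fine (ereal_sup S).
have SM : ereal_sup S = M%:E by rewrite fineK // ge0_fin_numE.
have M0 : 0 <= M by rewrite -lee_fin -SM.
(* Adding 1 makes positivity immediate. *)
exists (M + 1) => [|n]; first by rewrite ltr_wpDl.
have le_M1 r : r <= M -> r <= M + 1 by move/le_trans; apply; rewrite lerDl.
split=> [|x].
  by apply: le_M1; rewrite -lee_fin -SM; exact: ereal_sup_ubound.
have [->|x0] := eqVneq x 0.
  by rewrite linear0 (@nrm0 R k K^o) nrm0 mulr0.
have nx0 : 0 < nrm x by rewrite lt_neqAle eq_sym nrm_eq0 x0 nrm_ge0.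
rewrite -ler_pdivrMr //; apply: le_M1.
rewrite -lee_fin -SM; apply: le_trans (ereal_sup_ubound (Sd n)).
apply: ereal_sup_ubound; exists (of_real k (nrm x)^-1 *: x) => /=.
  by rewrite nrmZr ?invr_ge0 ?nrm_ge0 // mulVf ?gt_eqF.
congr (_%:E); rewrite linearZ /= nrmM nrm_of_real.
by rewrite ger0_norm ?invr_ge0 ?nrm_ge0 // mulrC.
Qed.

(** By density [x] is close to a finite combination [v] of the basis; beyond the length of [v] the
    functionals vanish on it, so they see only the small vector [x - v]. *)
Lemma Mbasis_tail (x : X) (eps : R) : 0 < eps ->
  exists N, forall n, (N <= n)%N -> nrm (es n x *: e n) <= eps.
Proof.
move=> eps0; have [M M0 hM] := Mbasis_bounded.
(* One factor [M] pays for the functional, the other for the norm of [e n]. *)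
pose d := eps / (M * M).
have d0 : 0 < d by rewrite divr_gt0 ?mulr_gt0.
have : closure (seq_span e) x by rewrite (mb_complete hB).
have dK : 0 < of_real k d by rewrite -(of_real0 R k) of_real_lt.
move=> /(_ _ (nbhsx_ballx x _ dK)) [v [[N [a vE]]]].
rewrite -ball_normE /= => xv; exists N => n Nn.
have nv : es n v = 0.
  rewrite vE linear_sum /= big1 // => i _; rewrite linearZ /= (mb_biorthogonal hB).
  by rewrite gtn_eqF ?scaler0 // (leq_trans (ltn_ord i)).
have -> : es n x = es n (x - v) by rewrite linearB /= nv subr0.
rewrite nrmZ; have [en esn] := hM n.
have xvd : nrm (x - v) <= d by rewrite nrmP ltW.
have -> : eps = (M * d) * M.
  by rewrite /d mulrAC mulrC divfK // gt_eqF ?mulr_gt0.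
apply: ler_pM; rewrite ?nrm_ge0 ?(@nrm_ge0 R k K^o) //.
by apply: le_trans (esn _) _; rewrite ler_wpM2l // ltW.
Qed.

(** Indices are added one at a time, with half of the error budget kept for the new one; smallness
    of single terms suffices, without convergence of the expansion. *)
Lemma Mbasis_far (x : X) (d : nat) (F : {fset nat}) (eps : R) : 0 < eps ->
  exists D : {fset nat}, [/\ #|` D| = d, [disjoint D & F]%fset
    & nrm (proj e es D x) <= eps].
Proof.
elim: d eps => [|d IH] eps eps0.
  exists fset0; rewrite cardfs0 fdisjoint0X; split=> //.
  by rewrite /proj big_seq_fset0 nrm0 ltW.
have e2 : 0 < eps / 2 by rewrite divr_gt0.
have [D [Dd DF De]] := IH _ e2.
have [N hN] := Mbasis_tail x e2.
(* [n] is at least [N], so its term is small, and exceeds every index of [D] and [F], so it is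
   new. *)
pose n := (N + \max_(i <- (D `|` F)%fset) i.+1)%N.
have nDF : n \notin (D `|` F)%fset.
  apply/negP => nDF.
  suff : (n.+1 <= \max_(i <- (D `|` F)%fset) i.+1)%N.
    by rewrite leqNgt /n ltnS leq_addl.
  exact: (@leq_bigmax_seq _ _ xpredT succn n nDF).
move: (nDF); rewrite in_fsetU negb_or => /andP[nD nF].
exists (n |` D)%fset; split.
- by rewrite cardfsU1 nD Dd.
- by rewrite fdisjointU1X nF.
- rewrite projU ?fdisjoint1X // (splitr eps).
  apply: le_trans (nrm_le_add _ _) (lerD _ De).
  by rewrite /proj big_seq_fset1 hN // leq_addr.
Qed.

End MbasisBounds.

(** * Truncation of large coefficients *)

Section Truncation.
Context (R : realType) (k : scalar_field).
Local Notation K := (scalars R k).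
Context (X : normedModType K).
Variables (e : nat -> X) (es : nat -> {linear X -> K^o}).
Variable tau : R.
Hypothesis htau : 0 < tau <= 1.

Local Notation coef x n := (nrm (es n x : K)).

(* Ordering [F] by decreasing coefficients makes every proper initial segment
   a weak greedy set of [y]; the truncated vector is an average of the
   remainders that these segments leave. *)
Lemma nrm_truncation (y : X) (F : {fset nat}) (t M : R) (eps : nat -> K) n0 :
  0 < t -> n0 \in F -> coef y n0 = t ->
  (forall n, n \in F -> t <= coef y n) ->
  (forall n, n \notin F -> tau * coef y n <= t) ->
  (forall n, n \in F -> es n y = of_real k (coef y n) * eps n) ->
  (forall L : {fset nat}, weak_greedy es tau y L -> (#|` L| < #|` F|)%N ->
     nrm (y - proj e es L y) <= M) ->
  nrm (y - proj e es F y + of_real k t *: signed_ind e eps F) <= M.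
Proof.
move=> t0 n0F n0t Ft nFt Feps hM; have /andP[tau0 tau1] := htau.
(* Multiplying the coefficient at [n] by [h n] brings its modulus down to [t]. *)
pose h n := t / coef y n.
have h1 n : n \in F -> 0 <= h n <= 1.
  move=> nF; have c0 := lt_le_trans t0 (Ft _ nF).
  by rewrite /h ler_pdivrMr // mul1r Ft // andbT divr_ge0 ?ltW.
have hn0 : h n0 = 1 by rewrite /h n0t divff ?gt_eqF.
pose leh := relpre h <=%R.
pose s' := sort leh (F `\ n0)%fset.
(* Increasing [h] means decreasing coefficients. [n0] goes last because [h n0 = 1] and
   [nrm_le_tails] needs the values to end at 1. *)
pose s := rcons s' n0.
have sF : perm_eq s F.
  apply: uniq_perm; rewrite ?fset_uniq //.
    by rewrite rcons_uniq mem_sort sort_uniq fset_uniq andbT in_fsetD1 eqxx.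
  move=> n; rewrite mem_rcons inE mem_sort in_fsetD1.
  by case: eqP => [->|//]; rewrite n0F.
have s'F n : n \in s' -> n \in F by rewrite mem_sort in_fsetD1 => /andP[].
have ps : path <=%R 0 (map h s).
  rewrite map_rcons rcons_path; apply/andP; split.
    rewrite path_sortedE; last exact: le_trans.
    apply/andP; split; first by apply/allP => _ /mapP[n /s'F/h1/andP[? _] ->].
    by rewrite sorted_map; apply: sort_sorted => i j; exact: le_total.
  rewrite hn0; have := mem_last 0 (map h s').
  by rewrite inE => /predU1P[->|/mapP[n /s'F/h1/andP[_ ?] ->]].
have ls : last 0 (map h s) = 1 by rewrite map_rcons last_rcons hn0.
have szs : size s = #|` F| by rewrite (perm_size sF).
have us : uniq s by rewrite (perm_uniq sF) fset_uniq.
have tails p q : s = p ++ q -> (0 < size q)%N ->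
    nrm (y - proj e es F y + \sum_(i <- q) es i y *: e i) <= M.
  move=> sE q0; pose L := [fset n in p]%fset.
  have up : uniq p by move: us; rewrite sE cat_uniq => /andP[].
  have Lp : perm_eq L p.
    by apply: uniq_perm; rewrite ?fset_uniq // => n; rewrite in_fset.
  have projF : proj e es F y = proj e es L y + \sum_(i <- q) es i y *: e i.
    rewrite /proj -(perm_big _ sF) sE big_cat /=; congr (_ + _).
    exact/esym/(perm_big _ Lp).
  (* Restoring the tail [q] leaves the remainder of [y] after the initial segment [L]; since [q] is
     nonempty, [L] is strictly smaller than [F]. *)
  rewrite projF opprD addrA subrK; apply: hM; last first.
    by rewrite (perm_size Lp) -szs sE size_cat -addn1 leq_add2l.
  apply/weak_greedyP => // i n iL; rewrite in_fset => np.
  have nF : n \in F by rewrite -(perm_mem sF) sE mem_cat np.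
  (* Outside [F] the coefficients compare through [t]; inside [F], [i] lies in the tail [q] and the
     sorting compares it with [n]. *)
  have [iF|iF] := boolP (i \in F); last by apply: le_trans (nFt _ iF) (Ft _ nF).
  have iq : i \in q.
    by move: iF iL; rewrite -(perm_mem sF) sE mem_cat in_fset => /orP[->|].
  have ci := lt_le_trans t0 (Ft _ iF); have cn := lt_le_trans t0 (Ft _ nF).
  apply: (@le_trans _ _ (coef y i)); first by rewrite ler_piMl // ltW.
  have : h n <= h i.
    move: (path_sorted ps); rewrite sorted_pairwise; last exact: le_trans.
    rewrite sE map_cat pairwise_cat => /andP[/allrelP hpq _].
    by apply: hpq; exact: map_f.
  by rewrite /h ler_pM2l // lef_pV2.
have := nrm_le_tails ps ls tails; rewrite subr0 mul1r of_real1 scale1r.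
congr (nrm (_ + _) <= _); rewrite -signed_indZ /signed_ind -(perm_big _ sF) /=.
apply: eq_big_seq => n ns; have nF : n \in F by rewrite -(perm_mem sF).
rewrite scalerA subr0; congr (_ *: _); rewrite (Feps n nF) mulrA -of_realM.
by rewrite divfK // gt_eqF // (lt_le_trans t0) ?Ft.
Qed.

End Truncation.

(** * The real-number estimates behind both inequalities *)

Section Bounds.
Context (R : realType) (k : scalar_field).
Local Notation K := (scalars R k).
Context (X : normedModType K).
Variables (e : nat -> X) (es : nat -> {linear X -> K^o}).
Hypothesis hB : Mbasis e es.
Variable tau : R.
Hypothesis htau : 0 < tau <= 1.

Local Notation coef x n := (nrm (es n x : K)).

Let be : biorthogonal e es := mb_biorthogonal hB.
Let tau0 : 0 < tau. Proof. by case/andP: htau. Qed.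

Lemma fset_argmin (F : {fset nat}) (f : nat -> R) : F != fset0 ->
  exists2 n0, n0 \in F & forall n, n \in F -> f n0 <= f n.
Proof.
case/fset0Pn => n nF.
have [[n0 n0F] _ hmin] := @arg_minP _ _ _ [` nF]%fset xpredT (fun i : F => f (val i)) isT.
by exists n0 => // i iF; exact: (hmin [` iF]%fset).
Qed.

Lemma supp_disjoint (A : {fset nat}) (x : X) :
  [set` A] `&` supp es x = set0 <-> forall n, n \in A -> es n x = 0.
Proof.
split=> [h n nA|h].
  apply/eqP/negPn/negP => xn; have : ([set` A] `&` supp es x) n by split.
  by rewrite h.
by apply/seteqP; split=> // n [/= nA]; rewrite /supp /= h ?eqxx.
Qed.

(** [G] and [N] stand for finite values of [gc] at size [m - 1] and [nu] at size [m]. The lower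
    bounds on them give [G * N / tau] at least [G], hence at least 1, which settles the degenerate
    cases. *)
Lemma weak_greedy_error_le (m : nat) (G N : R) (x : X) (L A : {fset nat}) :
  (0 < m)%N -> 1 <= G -> tau <= N ->
  (forall (y : X) (L' : {fset nat}), (#|` L'| <= m.-1)%N ->
     weak_greedy es tau y L' -> nrm (y - proj e es L' y) <= G * nrm y) ->
  (forall (y : X) A' B' eps d, nu_admissible e es m tau y A' B' eps d ->
     nrm (of_real k tau *: y + signed_ind e d B')
       <= N * nrm (y + signed_ind e eps A')) ->
  weak_greedy es tau x L -> #|` L| = m -> #|` A| = m ->
  nrm (x - proj e es L x) <= G * N / tau * nrm (x - proj e es A x).
Proof.
move=> m0 G1 tN hG hN /weak_greedyP-/(_ tau0) xL Lm Am.
have GNt : G <= G * N / tau.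
  by rewrite -mulrA ler_peMr ?(le_trans _ G1) // ler_pdivlMr ?mul1r.
pose F := (L `\` A)%fset; pose A' := (A `\` L)%fset.
have dAF : [disjoint A & F]%fset.
  by apply/fdisjointP => n nA; rewrite in_fsetD nA.
have dLA : [disjoint L & A']%fset.
  by apply/fdisjointP => n nL; rewrite in_fsetD nL.
have dFA : [disjoint F & A']%fset.
  by apply/fdisjointP => n; rewrite !in_fsetD => /andP[_ ->].
have cF : #|` F| = #|` A'| by rewrite !cardfsD Lm Am fsetIC.
have Fm : (#|` F| <= m)%N by rewrite cardfsD Lm leq_subr.
pose U := (A `|` L)%fset.
have UA : U = (A `|` F)%fset.
  by apply/fsetP => n; rewrite !in_fsetU in_fsetD; case: (n \in A).
have UL : U = (L `|` A')%fset.
  by apply/fsetP => n; rewrite !in_fsetU in_fsetD orbC; case: (n \in L).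
pose z := x - proj e es U x; pose y := x - proj e es A x.
have zL : x - proj e es L x = z + proj e es A' x.
  by rewrite /z UL projU // opprD addrA subrK.
have ey n : es n y = if n \in A then 0 else es n x.
  by rewrite linearB /= coef_proj //; case: ifP; rewrite ?subrr ?subr0.
have ez n : es n z = if n \in U then 0 else es n x.
  by rewrite linearB /= coef_proj //; case: ifP; rewrite ?subrr ?subr0.
have zy : z = y - proj e es F y.
  rewrite /z UA projU // opprD addrA; congr (_ - _).
  apply: eq_signed_ind => n; rewrite in_fsetD => /andP[nA _].
  by rewrite ey (negbTE nA).
rewrite zL -/y.
(* Equal cardinalities make [A'] empty too, so both remainders agree and a factor at least 1 is
   enough. *)
have [F0|F0] := eqVneq F fset0.
  have -> : A' = fset0 by apply/cardfs0_eq; rewrite -cF F0 cardfs0.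
  rewrite zy F0 /proj !big_seq_fset0 subr0 addr0.
  by rewrite ler_peMl ?nrm_ge0 // (le_trans G1).
have [n0 n0F hmin] := fset_argmin (fun n => coef x n) F0.
set t := coef x n0 in hmin.
have t_ge0 : 0 <= t by exact: (@nrm_ge0 R k K^o).
have FL n : n \in F -> n \in L by rewrite in_fsetD => /andP[].
have Fy n : n \in F -> es n y = es n x.
  by rewrite in_fsetD ey => /andP[/negbTE ->].
have nFt n : n \notin F -> tau * coef y n <= t.
  rewrite in_fsetD ey; case: ifP => [|nA]; first by rewrite (@nrm0 R k K^o) mulr0.
  by move=> nL; apply: xL (FL _ n0F).
have A't n : n \in A' -> tau * coef x n <= t.
  by rewrite in_fsetD => /andP[nL _]; apply: xL (FL _ n0F).
have [tE|tN0] := eqVneq t 0.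
  have coef0 n : tau * coef x n <= t -> es n x = 0.
    rewrite tE pmulr_rle0 // => xn; apply/eqP.
    by rewrite -(@nrm_eq0 R k K^o) eq_le xn (@nrm_ge0 R k K^o).
  have -> : proj e es A' x = 0.
    by apply: big1_seq => n /= nA; rewrite coef0 ?scale0r // A't.
  have x0 : es n0 x = 0 by apply/eqP; rewrite -(@nrm_eq0 R k K^o); apply/eqP.
  rewrite addr0 zy; apply: le_trans (ler_wpM2r (nrm_ge0 _) GNt).
  have -> : proj e es F y = proj e es (F `\ n0)%fset y.
    rewrite -{1}(fsetD1K n0F) projU ?fdisjoint1X ?in_fsetD1 ?eqxx //.
    by rewrite /proj big_seq_fset1 Fy // x0 scale0r add0r.
  apply: hG.
    by rewrite -ltnS (prednK m0); move: Fm; rewrite (cardfsD1 n0 F) n0F.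
  apply/weak_greedyP => // i n; rewrite in_fsetD1 negb_and negbK => iF _.
  apply: le_trans (@nrm_ge0 R k K^o _); rewrite -tE.
  case/orP: iF => [/eqP ->|]; last exact: nFt.
  by rewrite Fy // x0 (@nrm0 R k K^o) mulr0.
have t0 : 0 < t by rewrite lt_neqAle eq_sym tN0.
have [eps epsP] := choice (fun n => let: ex_intro2 u u1 uE :=
  nrm_polar (es n y : K) in ex_intro (fun u : K => `|u| = 1 /\
    es n y = of_real k (coef y n) * u) u (conj u1 uE)).
have trunc : nrm (z + of_real k t *: signed_ind e eps F) <= G * nrm y.
  rewrite zy; apply: (nrm_truncation htau (n0 := n0)) => //.
  - by rewrite Fy.
  - by move=> n nF; rewrite Fy // hmin.
  - by move=> n _; case: (epsP n).
  - by move=> L' L'y L'F; apply: hG L'y; rewrite -ltnS (prednK m0) (leq_trans L'F).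
(* Division by [t] turns the greedy bound [t / tau] on the coefficients of [z] into the bound
   [1 / tau] of [nu_admissible]. *)
pose w := of_real k t^-1 *: z.
have tw : of_real k t *: w = z.
  by rewrite scalerA -of_realM divff ?gt_eqF // of_real1 scale1r.
have ew n : es n w = of_real k t^-1 * es n z by rewrite linearZ.
have w0 n : n \in U -> es n w = 0 by rewrite ew ez => ->; rewrite mulr0.
have adm d : (forall n, `|d n| = 1) -> nu_admissible e es m tau w F A' eps d.
  move=> d1; split=> //.
  - apply/norm_inftyP => n; rewrite ew nrmM nrm_of_real ger0_norm ?invr_ge0 //.
    rewrite ler_pdivrMl // ler_pdivlMr // mulrC ez.
    case: ifP => [_|]; first by rewrite (@nrm0 R k K^o) mulr0.
    rewrite in_fsetU => /norP[_ nL]; exact: xL (FL _ n0F).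
  - split=> //; apply/supp_disjoint => n nF; apply: w0.
      by rewrite UA in_fsetU nF orbT.
    by rewrite UL in_fsetU nF orbT.
  - by split=> // n; case: (epsP n).
  (* The vector in the denominator is nonzero: its coefficient at [n0] is [eps n0], of modulus 1. *)
  - rewrite nrm_eq0; apply/eqP => /(congr1 (es n0)).
    rewrite linearD linear0 /= w0 ?UA ?in_fsetU ?n0F ?orbT // coef_signed_ind // n0F add0r.
    by have [+ _] := epsP n0 => /[swap] ->; rewrite normr0 => /esym/eqP; rewrite oner_eq0.
(* The coefficients of [x] on [A'] have modulus at most [t / tau], so it suffices to treat signs at
   exactly that height. *)
apply: (nrm_le_signs (r := t / tau)); rewrite ?divr_gt0 ?fset_uniq //.
  move=> d d1; have := hN _ _ _ _ _ (adm d d1).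
  rewrite -/(signed_ind e d A').
  have -> : z + of_real k (t / tau) *: signed_ind e d A' =
      of_real k (t / tau) *: (of_real k tau *: w + signed_ind e d A').
    by rewrite scalerDr scalerA -of_realM divfK ?gt_eqF // tw.
  have tt0 := ltW (divr_gt0 t0 tau0).
  rewrite nrmZr // => hw.
  apply: (@le_trans _ _ (t / tau * (N * nrm (w + signed_ind e eps F)))).
    by rewrite ler_wpM2l.
  have -> : t / tau * (N * nrm (w + signed_ind e eps F)) =
      N / tau * (t * nrm (w + signed_ind e eps F)) by ring.
  rewrite -(nrmZr _ (ltW t0)) scalerDr tw.
  have -> : G * N / tau * nrm y = N / tau * (G * nrm y) by ring.
  by rewrite ler_wpM2l // ltW // divr_gt0 // (lt_le_trans tau0).
by move=> n nA'; rewrite ler_pdivlMr // mulrC A't.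
Qed.

(* Large coefficients planted on a remote set of [m - j] indices belong to
   both sets, so a Lebesgue inequality at size [m] passes to smaller sizes. *)
Lemma lebesgue_ineq_le (m : nat) (C : R) : 0 <= C ->
  (forall (x : X) (L A : {fset nat}), weak_greedy es tau x L ->
     #|` L| = m -> #|` A| = m ->
     nrm (x - proj e es L x) <= C * nrm (x - proj e es A x)) ->
  forall (x : X) (L A : {fset nat}), weak_greedy es tau x L ->
     (#|` L| <= m)%N -> #|` A| = #|` L| ->
     nrm (x - proj e es L x) <= C * nrm (x - proj e es A x).
Proof.
move=> C0 hC x L A /weak_greedyP-/(_ tau0) xL Lm AL.
have [M M0 hM] := Mbasis_bounded hB.
have C10 : 0 < C + 1 by rewrite ltr_wpDl.
apply/ler_addgt0Pr => eta eta0.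
(* The projection on [D] is paid for once with factor [C] and once with factor 1, hence the budget
   [eta / (C + 1)]. *)
have [D [Dm DAL De]] := Mbasis_far hB x (m - #|` L|)%N (A `|` L)%fset
  (divr_gt0 eta0 C10).
have [DA DL] : [disjoint A & D]%fset /\ [disjoint L & D]%fset.
  by move: DAL; rewrite fdisjointXU ![[disjoint D & _]%fset]fdisjoint_sym => /andP.
(* This height dominates every coefficient of [x], so [L] enlarged by [D] stays weakly greedy for
   [y]. *)
pose a := of_real k (M * nrm x) : K.
pose y := x + signed_ind e (fun n => a - es n x) D.
have ey n : es n y = if n \in D then a else es n x.
  rewrite linearD /= coef_signed_ind //; case: ifP => _; last by rewrite addr0.
  by rewrite addrC subrK.
(* Both competing sets contain [D], so the planted coefficients cancel whatever their size. *)
have yE B : [disjoint B & D]%fset ->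
    y - proj e es (B `|` D)%fset y = x - proj e es B x - proj e es D x.
  move=> BD; rewrite projU // /y signed_indB.
  rewrite (_ : proj e es B _ = proj e es B x); last first.
    apply: eq_signed_ind => n nB; rewrite -/y -signed_indB ey.
    by rewrite (negbTE (fdisjointP BD _ nB)).
  rewrite (_ : proj e es D (_ + _) = signed_ind e (fun=> a) D); last first.
    by apply: eq_signed_ind => n nD; rewrite -signed_indB ey nD.
  by rewrite -projE opprD addrACA [_ - proj e es D x]addrC addrK.
have card B : #|` B| = #|` L| -> [disjoint B & D]%fset ->
    #|` (B `|` D)%fset| = m.
  move=> BL /eqP BD.
  by rewrite cardfsU BD cardfs0 subn0 BL Dm subnKC.
have := hC y (L `|` D)%fset (A `|` D)%fset.
rewrite !card // !yE // => /(_ _ erefl erefl) H.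
have {H} hy : nrm (x - proj e es L x - proj e es D x) <=
    C * nrm (x - proj e es A x - proj e es D x).
  apply: H; apply/weak_greedyP => // i n.
  rewrite !in_fsetU negb_or => /andP[iL iD] nLD.
  rewrite !ey (negbTE iD); case: ifP nLD => [nD _|_]; last first.
    by rewrite orbF; exact: xL.
  rewrite nrm_of_real ger0_norm ?(mulr_ge0 (ltW M0) (nrm_ge0 _)) //.
  have [_ /(_ x) hi] := hM i; apply: le_trans hi.
  by rewrite ler_piMl ?(@nrm_ge0 R k K^o) //; case/andP: htau.
apply: le_trans (nrm_le_subC _ (proj e es D x)) _.
apply: le_trans (lerD hy De) _.
have etaE : eta = C * (eta / (C + 1)) + eta / (C + 1).
  by field; exact: lt0r_neq0.
rewrite [X in _ <= _ + X]etaE addrA lerD2r -mulrDr ler_wpM2l //.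
by apply: le_trans (nrm_le_sub _ _) _; rewrite lerD2l.
Qed.

Lemma gc_ineq (m : nat) (C : R) : 0 <= C ->
  (forall (x : X) (L A : {fset nat}), weak_greedy es tau x L ->
     (#|` L| <= m)%N -> #|` A| = #|` L| ->
     nrm (x - proj e es L x) <= C * nrm (x - proj e es A x)) ->
  forall (x : X) (L : {fset nat}), weak_greedy es tau x L ->
     (#|` L| <= m)%N -> nrm (x - proj e es L x) <= C * nrm x.
Proof.
move=> C0 hC x L xL Lm; have C10 : 0 < C + 1 by rewrite ltr_wpDl.
apply/ler_addgt0Pr => eta eta0.
(* The competitor costs [C * (eta / (C + 1))], which is at most [eta]; the added 1 keeps the
   quotient meaningful when [C = 0]. *)
have [A [AL _ Ae]] := Mbasis_far hB x #|` L| fset0 (divr_gt0 eta0 C10).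
apply: le_trans (hC _ _ _ xL Lm AL) _.
apply: le_trans (ler_wpM2l C0 (nrm_le_sub _ _)) _.
rewrite mulrDr lerD2l; apply: le_trans (ler_wpM2l C0 Ae) _.
rewrite mulrCA ler_piMr ?(ltW eta0) // ler_pdivrMr // mul1r lerDl.
exact: ler01.
Qed.

Lemma nu_ineq (m : nat) (C : R) :
  (forall (x : X) (L A : {fset nat}), weak_greedy es tau x L ->
     (#|` L| <= m)%N -> #|` A| = #|` L| ->
     nrm (x - proj e es L x) <= C * nrm (x - proj e es A x)) ->
  forall (x : X) A B eps d, nu_admissible e es m tau x A B eps d ->
    nrm (of_real k tau *: x + signed_ind e d B)
      <= C * tau * nrm (x + signed_ind e eps A).
Proof.
move=> hC x A B eps d [/norm_inftyP xt [AB Am] [dAB]].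
move=> /supp_disjoint xA /supp_disjoint xB [eps1 d1] _.
pose y := x + signed_ind e eps A + of_real k tau^-1 *: signed_ind e d B.
have ey n : es n y = es n x + (if n \in A then eps n else 0)
    + of_real k tau^-1 * (if n \in B then d n else 0).
  by rewrite !linearD linearZ /= !coef_signed_ind.
have eA n : n \in A -> es n y = eps n.
  move=> nA; rewrite ey nA (negbTE (fdisjointP dAB _ nA)) xA //.
  by rewrite mulr0 addr0 add0r.
have eB n : n \in B -> es n y = of_real k tau^-1 * d n.
  move=> nB; have nA : n \notin A.
    by apply/negP => /(fdisjointP dAB); rewrite nB.
  by rewrite ey nB (negbTE nA) xB // !add0r.
(* Coefficients of [y] have modulus 1 on [A] and at most [1 / tau] elsewhere, so [A] just meets the
   weak greedy threshold. *)
have yA : weak_greedy es tau y A.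
  apply/weak_greedyP => // i n iA nA; rewrite (eA n) // (nrm_unit (eps1 n)).
  rewrite mulrC -ler_pdivlMr // div1r.
  have [iB|iB] := boolP (i \in B).
    by rewrite eB // nrmM nrm_of_real (nrm_unit (d1 i)) mulr1 ger0_norm // invr_ge0 ltW.
  by rewrite ey (negbTE iA) (negbTE iB) mulr0 !addr0.
have := hC y A B yA Am (esym AB).
have -> : y - proj e es A y = of_real k tau^-1 *: (of_real k tau *: x + signed_ind e d B).
  rewrite (_ : proj e es A y = signed_ind e eps A); last exact: eq_signed_ind.
  rewrite /y addrAC addrK scalerDr scalerA -of_realM mulVf ?gt_eqF //.
  by rewrite of_real1 scale1r.
have -> : y - proj e es B y = x + signed_ind e eps A.
  rewrite (_ : proj e es B y = of_real k tau^-1 *: signed_ind e d B) ?addrK //.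
  by rewrite -signed_indZ; exact: eq_signed_ind.
by rewrite nrmZr ?invr_ge0 ?(ltW tau0) // ler_pdivrMl // mulrCA mulrA.
Qed.

End Bounds.

(** * Passage between real inequalities and the extended-real constants *)

Section Constants.
Context (R : realType) (k : scalar_field).
Local Notation K := (scalars R k).
Context (X : normedModType K).
Variables (e : nat -> X) (es : nat -> {linear X -> K^o}).
Variables (m : nat) (tau : R).

Lemma lebesgue_ineq (C : R) : 0 <= C ->
  (forall x, (greedy_error e es m tau x <= C%:E * proj_error e es m x)%E) ->
  forall (x : X) (L A : {fset nat}), weak_greedy es tau x L ->
    #|` L| = m -> #|` A| = m ->
    nrm (x - proj e es L x) <= C * nrm (x - proj e es A x).
Proof.
move=> C0 hC x L A xL Lm Am; rewrite -lee_fin EFinM.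
have le_err : ((nrm (x - proj e es L x))%:E <= greedy_error e es m tau x)%E.
  by apply: ereal_sup_ubound; exists L.
apply: le_trans le_err _; apply: le_trans (hC x) _.
rewrite lee_wpmul2l ?lee_fin //; apply: ereal_inf_lbound.
by exists A.
Qed.

Lemma lebesgue_le (C : R) : 0 < C ->
  (forall (x : X) (L A : {fset nat}), weak_greedy es tau x L ->
    #|` L| = m -> #|` A| = m ->
    nrm (x - proj e es L x) <= C * nrm (x - proj e es A x)) ->
  (lebesgue e es m tau <= C%:E)%E.
Proof.
move=> C0 hC; apply: ereal_inf_lbound; split; first by rewrite lee_fin ltW.
move=> x; apply: ge_ereal_sup => _ [L [xL Lm] <-].
(* With [C] positive it moves to the other side, and the infimum can then be tested one competitor
   at a time. *)
rewrite -(invrK C) -lee_pdivrMl ?invr_gt0 // invrK.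
rewrite -EFinM; apply: le_ereal_inf_tmp => _ [A Am <-].
by rewrite lee_fin ler_pdivrMl // hC.
Qed.

(** The infimum defining [gc] is itself admissible: for nonzero [x], dividing by its norm gives a
    lower bound of all admissible constants. *)
Lemma gc_bound (j : nat) (x : X) (L : {fset nat}) :
  weak_greedy es tau x L -> (#|` L| <= j)%N ->
  ((nrm (x - proj e es L x))%:E <= gc e es j tau * (nrm x)%:E)%E.
Proof.
move=> xL Lj; have [->|x0] := eqVneq x 0.
  by rewrite /proj big1 ?subrr ?nrm0 ?mule0 // => n _; rewrite linear0 scale0r.
have nx0 : 0 < nrm x by rewrite lt_neqAle eq_sym nrm_eq0 x0 nrm_ge0.
rewrite -lee_pdivrMr //; apply: le_ereal_inf_tmp => C [_ hC].
by rewrite lee_pdivrMr //; apply: (hC _ _ _ Lj).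
Qed.

Lemma nu_bound (x : X) (A B : {fset nat}) (eps d : nat -> K) :
  nu_admissible e es m tau x A B eps d ->
  ((nrm (of_real k tau *: x + signed_ind e d B))%:E
    <= nu e es m tau * (nrm (x + signed_ind e eps A))%:E)%E.
Proof.
move=> adm; case: (adm) => _ _ _ _ n0.
have nx0 : 0 < nrm (x + signed_ind e eps A).
  by rewrite lt_neqAle eq_sym n0 nrm_ge0.
rewrite -lee_pdivrMr // -EFinM; apply: ereal_sup_ubound.
by exists x, A, B, eps, d.
Qed.

Lemma gc_ge1 (j : nat) : 0 < tau -> (exists x : X, x != 0) ->
  (1 <= gc e es j tau)%E.
Proof.
move=> tau0 [x x0].
have nx0 : 0 < nrm x by rewrite lt_neqAle eq_sym nrm_eq0 x0 nrm_ge0.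
have x_greedy : weak_greedy es tau x fset0 by exact/weak_greedyP.
have := gc_bound x_greedy (leq0n j).
rewrite /proj big_seq_fset0 subr0 -lee_pdivrMr // -EFinM divff ?gt_eqF //.
Qed.

Lemma nu_ge : 0 < tau -> (exists x : X, x != 0) ->
  (exists2 M : R, 0 < M & forall n (x : X), nrm (es n x : K) <= M * nrm x) ->
  (tau%:E <= nu e es m tau)%E.
Proof.
move=> tau0 [x x0] [M M0 hM].
have nx0 : 0 < nrm x by rewrite lt_neqAle eq_sym nrm_eq0 x0 nrm_ge0.
(* Scaling by [c] brings all coefficients below [1 / tau]; with [A] and [B] empty the quotient is
   then exactly [tau]. *)
pose c := (tau * (M * nrm x))^-1.
have c0 : 0 < c by rewrite invr_gt0 !mulr_gt0.
pose w := of_real k c *: x.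
have nw : 0 < nrm w by rewrite nrmZr ?(ltW c0) // mulr_gt0.
have w0 : w + signed_ind e (fun=> 1) fset0 = w.
  by rewrite /signed_ind big_seq_fset0 addr0.
have adm : nu_admissible e es m tau w fset0 fset0 (fun=> 1) (fun=> 1).
  split; rewrite ?w0 ?gt_eqF //.
  - apply/norm_inftyP => n; rewrite linearZ /= nrmM nrm_of_real gtr0_norm //.
    rewrite /c invfM -mulrA ler_piMr ?invr_ge0 ?(ltW tau0) //.
    by rewrite ler_pdivrMl ?mulr_gt0 // mulr1.
  - by rewrite fdisjoint0X; split=> //; apply/seteqP; split=> // n [].
  - by split=> n; rewrite normr1.
have := nu_bound adm; rewrite w0 /signed_ind big_seq_fset0 addr0.
by rewrite nrmZr ?(ltW tau0) // EFinM lee_pmul2r.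
Qed.

End Constants.

Theorem theorem1p2 (R : realType) (k : scalar_field)
    (X : completeNormedModType (scalars R k))
    (hX : infinite_dimensional X)
    (e : nat -> X) (es : nat -> {linear X -> (scalars R k)^o})
    (hB : Mbasis e es)
    (tau : R) (htau : 0 < tau <= 1)
    (m : nat) (hm : (0 < m)%N) :
  (maxe (gc e es m tau) (nu e es m tau * (tau^-1)%:E)
     <= lebesgue e es m tau)%E /\
  (lebesgue e es m tau
     <= gc e es m.-1 tau * nu e es m tau * (tau^-1)%:E)%E.
Proof.
have tau0 : 0 < tau by case/andP: htau.
split.
  (* Only a real [C] needs an argument: [+oo] bounds everything and [-oo] is not nonnegative. *)
  apply: le_ereal_inf_tmp => -[C| |] [C0 hC]; rewrite ?leey //.
  rewrite lee_fin in C0.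
  have {}hC := lebesgue_ineq_le hB htau C0 (lebesgue_ineq C0 hC).
  rewrite ge_max; apply/andP; split.
    apply: ereal_inf_lbound; split; first by rewrite lee_fin.
    move=> x j L jm [xL Lj]; rewrite -EFinM lee_fin.
    by apply: (gc_ineq hB C0 hC xL); rewrite Lj.
  rewrite lee_pdivrMr // -EFinM; apply: ge_ereal_sup => _ [x [A [B [eps [d [adm ->]]]]]].
  have := nu_ineq hB htau hC adm; case: adm => _ _ _ _ n0.
  by rewrite lee_fin ler_pdivrMr // lt_neqAle eq_sym n0 nrm_ge0.
have X0 : exists x : X, x != 0 by exists (e 0%N); exact: (Mbasis_neq0 hB).
have gc1 := gc_ge1 e es m.-1 tau0 X0.
have nu_tau : (tau%:E <= nu e es m tau)%E.
  apply: nu_ge => //; have [M M0 hM] := Mbasis_bounded hB.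
  by exists M => // n; case: (hM n).
have tauV0 : (0 < (tau^-1)%:E)%E by rewrite lte_fin invr_gt0.
have nu0 : (0 < nu e es m tau)%E by apply: lt_le_trans nu_tau; rewrite lte_fin.
have gc0 : (0 < gc e es m.-1 tau)%E by apply: lt_le_trans gc1; rewrite lte_fin.
(* Since both constants are positive, an infinite factor makes the product [+oo] and the bound
   trivial; otherwise both are real. *)
have [gy|gy] := eqVneq (gc e es m.-1 tau) +oo%E.
  by rewrite gy gt0_mulye // gt0_mulye // leey.
have [ny|ny] := eqVneq (nu e es m tau) +oo%E.
  by rewrite ny gt0_muley // gt0_mulye // leey.
have gcE : gc e es m.-1 tau = (fine (gc e es m.-1 tau))%:E.
  by rewrite fineK // gt0_fin_numE // ltey.
have nuE : nu e es m tau = (fine (nu e es m tau))%:E.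
  by rewrite fineK // gt0_fin_numE // ltey.
move: (fine _) (fine _) gcE nuE => G N gcE nuE.
rewrite gcE lee_fin in gc1; rewrite nuE lee_fin in nu_tau.
rewrite gcE nuE -!EFinM; apply: lebesgue_le.
  by rewrite divr_gt0 // mulr_gt0 ?(lt_le_trans _ gc1) ?(lt_le_trans _ nu_tau).
move=> x L A xL Lm Am; apply: (weak_greedy_error_le hB htau hm) => //.
  by move=> y L' L'm yL'; rewrite -lee_fin EFinM -gcE gc_bound.
by move=> y A' B' eps d adm; rewrite -lee_fin EFinM -nuE nu_bound.
Qed.
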